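(* Let $D_1$ and $D_2$ be maximal Arrow's single-peaked domains on a finite set $A$, both with $P$ and $Q=\theta(P)$ as extremal paths, where $\theta$ is a permutation of $A$ (swapping the two terminal vertices), and suppose $D_1\neq D_2$. If $D_1$ and $D_2$ are isomorphic, then $\theta$ is the isomorphism between the two. Consequently, if $\theta$ is not of order $2$, then $D_1$ and $D_2$ cannot be isomorphic.
   Context: A linear order on a finite set $A$ of size $m$ is identified with a directed Hamilton path through $A$, i.e. a sequence $(a_1,\dots,a_m)$ listing every element of $A$ exactly once (most preferred first). A set $D$ of linear orders on $A$ is a Condorcet domain if there are no three orders in $D$ and distinct $a_1,a_2,a_3\in A$ such that the three orders rank these elements as $a_1\succ a_2\succ a_3$, $a_2\succ a_3\succ a_1$, $a_3\succ a_1\succ a_2$ respectively. It is maximal if it is not properly contained in another Condorcet domain on $A$. An Arrow's single-peaked domain is a Condorcet domain $D$ such that every triple (3-element subset) $T\subseteq A$ has a ''never-bottom'' element, i.e. an element of $T$ which no order of $D$ ranks last among the elements of $T$. A maximal Arrow's single-peaked domain is an Arrow's single-peaked domain which is maximal as a Condorcet domain. A terminal vertex of $D$ is an element which is last in some order of $D$; a maximal Arrow's single-peaked domain has exactly two terminal vertices. A path in $D$ is extremal if it starts at one terminal vertex and ends at the other; such a $D$ has exactly two extremal paths. Permutations act on paths entrywise. An isomorphism between $D_1$ and $D_2$ is a permutation $\phi$ of $A$ with $\{\phi(W):W\in D_1\}=D_2$. *)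

(* Defs.v *)
From HB Require Import structures.
From mathcomp Require Import all_boot all_fingroup.

Set Implicit Arguments.
Unset Strict Implicit.
Unset Printing Implicit Defensive.

(* A duplicate-free sequence of length #|A| lists every element of A exactly
   once (count_lorder), the most preferred element coming first. *)
Record lorder (A : finType) := LOrder {
  lorder_val :> #|A|.-tuple A;
  lorder_uniq : uniq lorder_val
}.

HB.instance Definition _ (A : finType) := [isSub for @lorder_val A].
HB.instance Definition _ (A : finType) := [Finite of lorder A by <:].

Lemma count_lorder (A : finType) (W : lorder A) (a : A) : count_mem a W = 1.
Proof.
rewrite count_uniq_mem ?lorder_uniq //.
have [||_ ->] := uniq_min_size (s2 := enum A) (lorder_uniq W).
- by move=> x _; rewrite mem_enum.
- by rewrite -cardE size_tuple.
- by rewrite mem_enum.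
Qed.

Definition prefers (A : finType) (W : lorder A) (a b : A) : bool :=
  index a W < index b W.

Definition ranks3 (A : finType) (W : lorder A) (a b c : A) : bool :=
  prefers W a b && prefers W b c.

Definition condorcet (A : finType) (D : {set lorder A}) : Prop :=
  forall W1 W2 W3 : lorder A, W1 \in D -> W2 \in D -> W3 \in D ->
  forall a1 a2 a3 : A, uniq [:: a1; a2; a3] ->
  ~ [/\ ranks3 W1 a1 a2 a3, ranks3 W2 a2 a3 a1 & ranks3 W3 a3 a1 a2].

Definition maximal_condorcet (A : finType) (D : {set lorder A}) : Prop :=
  condorcet D /\
  forall D' : {set lorder A}, condorcet D' -> ~~ (D \proper D').

Definition ranks_last (A : finType) (W : lorder A) (T : {set A}) (x : A) :
  bool := [forall y in T, (y != x) ==> prefers W y x].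

Definition never_bottom (A : finType) (D : {set lorder A}) (T : {set A})
    (x : A) : Prop :=
  x \in T /\ forall W : lorder A, W \in D -> ~~ ranks_last W T x.

Definition arrow_single_peaked (A : finType) (D : {set lorder A}) : Prop :=
  condorcet D /\
  forall T : {set A}, #|T| = 3 -> exists x : A, never_bottom D T x.

Definition maximal_arrow_single_peaked (A : finType) (D : {set lorder A}) :
  Prop := arrow_single_peaked D /\ maximal_condorcet D.

(* The default values of head and last are never used: the mere presence of
   x : A makes every W : lorder A a nonempty sequence. *)
Definition starts_at (A : finType) (W : lorder A) (x : A) : Prop :=
  head x W = x.

Definition ends_at (A : finType) (W : lorder A) (x : A) : Prop :=
  last x W = x.

Definition terminal (A : finType) (D : {set lorder A}) (x : A) : Prop :=
  exists2 W : lorder A, W \in D & ends_at W x.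

Definition extremal (A : finType) (D : {set lorder A}) (W : lorder A) : Prop :=
  W \in D /\
  exists x y : A, [/\ x != y, terminal D x, terminal D y,
                      starts_at W x & ends_at W y].

(* Quantifying over ordered pairs (x, y) gives both halves of the swap. *)
Definition swaps_terminals (A : finType) (theta : {perm A})
    (D : {set lorder A}) : Prop :=
  forall x y : A, x != y -> terminal D x -> terminal D y -> theta x = y.

Lemma perm_lorder_subproof (A : finType) (phi : {perm A}) (W : lorder A) :
  uniq (map_tuple phi W).
Proof. by rewrite /= map_inj_uniq ?lorder_uniq //; apply: perm_inj. Qed.

Definition perm_lorder (A : finType) (phi : {perm A}) (W : lorder A) :
  lorder A := LOrder (perm_lorder_subproof phi W).

Definition isomorphism (A : finType) (D1 D2 : {set lorder A})
    (phi : {perm A}) : Prop :=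
  [set perm_lorder phi W | W in D1] = D2.

Definition isomorphic (A : finType) (D1 D2 : {set lorder A}) : Prop :=
  exists phi : {perm A}, isomorphism D1 D2 phi.

(* Main.v *)
Require Import Defs.
From mathcomp Require Import all_boot all_fingroup cyclic.

Set Implicit Arguments.
Unset Strict Implicit.
Unset Printing Implicit Defensive.

(** The never-bottom condition says that no triple is ranked last by each of
    its three elements.  It is used twice.  Applied to three terminal vertices
    it shows that there are at most two ([terminal_at_most_two]).  Applied to a
    terminal vertex [x] and two elements [a], [b] it shows that the orders of
    [D] starting at [x] agree on [a] and [b]: two that disagree rank [a] last
    and [b] last in the triple, and an order ending at [x] ranks [x] last.
    Hence an extremal path is determined by its starting vertex
    ([start_terminal_inj]), and since [P] and its image [Q] start at different
    terminal vertices, they are all the extremal paths ([extremal_cases]).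

    An isomorphism [phi] carries extremal paths to extremal paths, so [phi P]
    is [P] or [Q].  A permutation is determined by the image of a single linear
    order ([perm_lorder_inj]).  Therefore [phi P = P] would give [phi = 1] and
    [D1 = D2], and the remaining case [phi P = Q = theta P] gives
    [phi = theta].  The same dichotomy holds for [theta Q]: it is not [Q], since
    [theta] exchanges the terminal vertices and so is not [1], hence
    [theta (theta P) = P] and [theta] has order [2]. *)

Lemma mem_lorder (A : finType) (W : lorder A) (a : A) : a \in tval W.
Proof. by rewrite -has_pred1 has_count count_lorder. Qed.

Lemma starts_at_prefers (A : finType) (W : lorder A) (x a : A) :
  starts_at W x -> a != x -> prefers W x a.
Proof.
rewrite /starts_at /prefers; have := mem_lorder W x.
case: (tval W) => [|z s] /=; first by rewrite in_nil.
by move=> _ ->; rewrite eqxx eq_sym; case: eqP.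
Qed.

Lemma ends_at_prefers (A : finType) (W : lorder A) (x a : A) :
  ends_at W x -> a != x -> prefers W a x.
Proof.
rewrite /ends_at /prefers; have := lorder_uniq W.
have := mem_lorder W x; have := mem_lorder W a.
case: (tval W) => [|z s]; first by rewrite in_nil.
move=> a_s x_s Us lastx a'x.
have idx : index x (z :: s) = size s.
  by rewrite -(index_last Us); congr index.
rewrite idx ltn_neqAle -ltnS (index_mem a (z :: s)) a_s andbT -idx.
by apply: contraNneq a'x => /(index_inj z a_s x_s) ->.
Qed.

Lemma prefers_total (A : finType) (W : lorder A) (a b : A) :
  a != b -> ~~ prefers W a b -> prefers W b a.
Proof.
move=> a'b; rewrite /prefers -leqNgt leq_eqVlt => /orP[/eqP eq_ba|//].
by rewrite (index_inj a (mem_lorder W b) (mem_lorder W a) eq_ba) eqxx in a'b.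
Qed.

Lemma sorted_prefers (A : finType) (W : lorder A) : sorted (prefers W) W.
Proof.
case defW: (tval W) => [|z s] //; rewrite -defW; apply/(sortedP z) => i lti.
by rewrite /prefers !index_uniq ?lorder_uniq // ltnW.
Qed.

(** Two strict linear orders, one of which contains the other, coincide: both
    sequences are sorted for the larger relation and have the same elements. *)
Lemma lorder_inversion (A : finType) (W1 W2 : lorder A) :
  W1 != W2 -> exists a b, prefers W1 a b && prefers W2 b a.
Proof.
move=> W1'W2.
case: (boolP [exists a, exists b, prefers W1 a b && prefers W2 b a]).
  by case/existsP=> a /existsP[b Hab]; exists a, b.
move=> noinv; case/eqP: W1'W2; do 2!apply: val_inj => /=.
apply: (@irr_sorted_eq _ (prefers W2)).
- by move=> ? ? ?; apply: ltn_trans.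
- by move=> a; apply: ltnn.
- apply: sub_sorted (sorted_prefers W1) => a b Wab.
  apply: contraNT noinv => W2'ab.
  apply/existsP; exists a; apply/existsP; exists b; rewrite Wab prefers_total //.
  by apply: contraTneq Wab => ->; rewrite /prefers ltnn.
- exact: sorted_prefers.
- by move=> a; rewrite !mem_lorder.
Qed.

(** The never-bottom condition restated through pairwise preferences, which is
    what orders with a known first or last element provide. *)
Lemma not_all_bottom (A : finType) (D : {set lorder A}) (a b c : A)
    (Wa Wb Wc : lorder A) :
  arrow_single_peaked D -> uniq [:: a; b; c] ->
  Wa \in D -> Wb \in D -> Wc \in D ->
  prefers Wa b a -> prefers Wa c a -> prefers Wb a b -> prefers Wb c b ->
  prefers Wc a c -> prefers Wc b c -> False.
Proof.
move=> [_ nb] Uabc DWa DWb DWc Wba Wca Wab Wcb Wac Wbc.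
have [|x [xT notlast]] := nb [set x in [:: a; b; c]].
  by rewrite cardsE (card_uniqP Uabc).
have last_in W y : W \in D ->
    all (fun z => (z != y) ==> prefers W z y) [:: a; b; c] -> y != x.
  move=> DW /allP lasty; apply: contraNneq (notlast W DW) => <-.
  by apply/forall_inP => z; rewrite inE; apply: lasty.
have /[!inE] := xT; have := last_in Wc c DWc.
have := last_in Wb b DWb; have := last_in Wa a DWa.
rewrite /= !eqxx Wba Wca Wab Wcb Wac Wbc !implybT /= ![_ == x]eq_sym.
by do 3![move=> /(_ isT) /negPf ->].
Qed.

Lemma terminal_at_most_two (A : finType) (D : {set lorder A}) (x y z : A) :
  arrow_single_peaked D -> terminal D x -> terminal D y -> terminal D z ->
  x != y -> z = x \/ z = y.
Proof.
move=> aspD [Wx DWx Wx_x] [Wy DWy Wy_y] [Wz DWz Wz_z] x'y.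
have [|z'x] := eqVneq z x; first by left.
have [|z'y] := eqVneq z y; first by right.
have [y'x x'z y'z] : [/\ y != x, x != z & y != z] by rewrite ![_ == z]eq_sym eq_sym.
case: (@not_all_bottom A D x y z Wx Wy Wz); rewrite ?ends_at_prefers //=.
by rewrite !inE negb_or x'y x'z y'z.
Qed.

(** A disagreement of [W1] and [W2] on [a] and [b], together with an order that
    ends at [x], would put each of [a], [b], [x] last in their triple. *)
Lemma start_terminal_inj (A : finType) (D : {set lorder A}) (x : A)
    (W1 W2 : lorder A) :
  arrow_single_peaked D -> terminal D x -> W1 \in D -> W2 \in D ->
  starts_at W1 x -> starts_at W2 x -> W1 = W2.
Proof.
move=> aspD [Wx DWx Wx_x] DW1 DW2 W1x W2x; apply/eqP; apply: contraT.
case/lorder_inversion=> a [b /andP[W1ab W2ba]].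
have after_start W c d : starts_at W x -> prefers W c d -> d != x.
  move=> Wx0; apply: contraTneq => ->; rewrite /prefers -leqNgt.
  have [-> //|c'x] := eqVneq c x.
  exact: ltnW (starts_at_prefers Wx0 c'x).
have a'x := after_start _ _ _ W2x W2ba; have b'x := after_start _ _ _ W1x W1ab.
have a'b : a != b by apply: contraTneq W1ab => ->; rewrite /prefers ltnn.
have Uabx : uniq [:: a; b; x] by rewrite /= !inE negb_or a'b a'x b'x.
by case: (not_all_bottom aspD Uabx DW2 DW1 DWx W2ba _ W1ab); auto using
  starts_at_prefers, ends_at_prefers.
Qed.

Lemma extremal_cases (A : finType) (D : {set lorder A}) (x y : A)
    (P Q W : lorder A) :
  arrow_single_peaked D -> terminal D x -> terminal D y -> x != y ->
  P \in D -> Q \in D -> starts_at P x -> starts_at Q y ->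
  extremal D W -> W = P \/ W = Q.
Proof.
move=> aspD Tx Ty x'y DP DQ Px Qy [DW [z [_ [_ Tz _ Wz _]]]].
case: (terminal_at_most_two aspD Tx Ty Tz x'y) => eqz; rewrite eqz in Wz.
  by left; apply: start_terminal_inj aspD Tx DW DP Wz Px.
by right; apply: start_terminal_inj aspD Ty DW DQ Wz Qy.
Qed.

(** Every element of [A] occurs in the sequence [W], so its image under a
    permutation can be read off from the image of [W]. *)
Lemma perm_lorder_inj (A : finType) (phi psi : {perm A}) (W : lorder A) :
  perm_lorder phi W = perm_lorder psi W -> phi = psi.
Proof.
move=> /(congr1 (fun U : lorder A => tval U)) /= /eq_in_map eqW.
by apply/permP => a; apply: eqW; apply: mem_lorder.
Qed.

Lemma perm_lorder1 (A : finType) (W : lorder A) : perm_lorder 1%g W = W.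
Proof.
by do 2!apply: val_inj => /=; rewrite -[RHS]map_id; apply: eq_map => a; rewrite perm1.
Qed.

Lemma perm_lorderM (A : finType) (phi psi : {perm A}) (W : lorder A) :
  perm_lorder (phi * psi)%g W = perm_lorder psi (perm_lorder phi W).
Proof.
by do 2!apply: val_inj => /=; rewrite -map_comp; apply: eq_map => a; rewrite permM.
Qed.

Lemma starts_at_perm (A : finType) (phi : {perm A}) (W : lorder A) (x : A) :
  starts_at W x -> starts_at (perm_lorder phi W) (phi x).
Proof. by rewrite /starts_at /=; case: (tval W) => [|z s] //= ->. Qed.

Lemma ends_at_perm (A : finType) (phi : {perm A}) (W : lorder A) (x : A) :
  ends_at W x -> ends_at (perm_lorder phi W) (phi x).
Proof. by rewrite /ends_at /= last_map => ->. Qed.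

Lemma isomorphism_mem (A : finType) (D1 D2 : {set lorder A}) (phi : {perm A})
    (W : lorder A) :
  isomorphism D1 D2 phi -> W \in D1 -> perm_lorder phi W \in D2.
Proof. by move=> <-; apply: imset_f. Qed.

Lemma isomorphism_extremal (A : finType) (D1 D2 : {set lorder A})
    (phi : {perm A}) (W : lorder A) :
  isomorphism D1 D2 phi -> extremal D1 W -> extremal D2 (perm_lorder phi W).
Proof.
move=> iso [DW [x [y [x'y Tx Ty Wx Wy]]]]; split; first exact: isomorphism_mem iso DW.
have Tphi z : terminal D1 z -> terminal D2 (phi z).
  case=> U DU Uz; exists (perm_lorder phi U); last exact: ends_at_perm.
  exact: isomorphism_mem iso DU.
exists (phi x), (phi y); rewrite (inj_eq perm_inj).
by split; auto using starts_at_perm, ends_at_perm.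
Qed.

Unset Implicit Arguments.

Theorem lemma5p3 (A : finType) (D1 D2 : {set lorder A})
    (P Q : lorder A) (theta : {perm A})
    (hD1 : maximal_arrow_single_peaked D1)
    (hD2 : maximal_arrow_single_peaked D2)
    (hP1 : extremal D1 P) (hQ1 : extremal D1 Q)
    (hP2 : extremal D2 P) (hQ2 : extremal D2 Q)
    (hQ : Q = perm_lorder theta P)
    (hswap : swaps_terminals theta D1)
    (hneq : D1 <> D2) :
  (isomorphic D1 D2 ->
     isomorphism D1 D2 theta /\
     forall phi : {perm A}, isomorphism D1 D2 phi -> phi = theta) /\
  (#[theta]%g <> 2 -> ~ isomorphic D1 D2).
Proof.
have [_ [x [y [x'y Tx1 Ty1 Px Py]]]] := hP1.
have Qy : starts_at Q y.
  by rewrite hQ -(hswap x y x'y Tx1 Ty1); apply: starts_at_perm.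
(* The terminal vertices of [D2] are [x] and [y] as well, because [Q] starts at
   [y] and [P] at [x], and an extremal path starts at a terminal vertex. *)
have start_terminal W z : extremal D2 W -> starts_at W z -> terminal D2 z.
  move=> [_ [u [_ [_ Tu _ Wu _]]]] Wz; suff -> : z = u by [].
  move: (mem_lorder W z) Wz Wu; rewrite /starts_at.
  case: (tval W) => [|v s] /=; first by rewrite in_nil.
  by move=> _ -> ->.
have [[D2P _] [D2Q _]] := (hP2, hQ2).
have cases W : extremal D2 W -> W = P \/ W = Q.
  apply: (@extremal_cases A D2 x y) => //; first by case: hD2.
    exact: start_terminal hP2 Px.
  exact: start_terminal hQ2 Qy.
have uniq_iso phi : isomorphism D1 D2 phi -> phi = theta.
  move=> iso; case: (cases _ (isomorphism_extremal iso hP1)) => [fixP|phiP].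
    case: hneq; rewrite -iso (_ : phi = 1%g); last first.
      by apply: (@perm_lorder_inj _ _ _ P); rewrite fixP perm_lorder1.
    by rewrite (eq_imset _ (@perm_lorder1 A)) imset_id.
  by apply: (@perm_lorder_inj _ _ _ P); rewrite phiP.
have theta_iso : isomorphic D1 D2 -> isomorphism D1 D2 theta.
  by case=> phi iso; rewrite -(uniq_iso phi iso).
split=> [iso|]; first by split; [apply: theta_iso | apply: uniq_iso].
move=> theta'2 /theta_iso iso; apply: theta'2.
have theta_neq1 : theta != 1%g.
  by apply: contraNneq (x'y) => th1; rewrite -(hswap x y) // th1 perm1.
suff theta2 : (theta ^+ 2 = 1)%g by apply: nt_prime_order.
apply: (@perm_lorder_inj _ _ _ P).
rewrite perm_lorder1 expgS expg1 perm_lorderM -hQ.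
case: (cases _ (isomorphism_extremal iso hQ1)) => // fixQ.
case/eqP: theta_neq1; apply: (@perm_lorder_inj _ _ _ Q).
by rewrite fixQ perm_lorder1.
Qed.
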